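(* For a positive integer $g$, let $t_g$ denote the number of numerical semigroups $\Lambda$ of genus $g$ satisfying $f(\Lambda) < 3m(\Lambda)$. Let $\varphi = \frac{1+\sqrt5}{2}$. Then \[ \lim_{g \to \infty} t_g \varphi^{-g} = \frac{\varphi}{\sqrt 5} + \frac{1}{\sqrt 5} \sum_{k = 1}^{\infty} \sum_{A \in \mathcal A_k} \varphi^{ - |(A + A)\cap[0, k]| + |A| - k - 1}. \]
   Context: A numerical semigroup is a subset $\Lambda\subseteq\mathbb{N}_0$ closed under addition, containing $0$, with finite complement in $\mathbb{N}_0$. Its genus $g(\Lambda)$ is $|\mathbb{N}_0\setminus\Lambda|$, its multiplicity $m(\Lambda)$ is its smallest nonzero element, and its Frobenius number $f(\Lambda)$ is the largest element of $\mathbb{N}_0\setminus\Lambda$. For integers $a\le b$, $[a,b]=\{a,a+1,\dots,b\}$. For $A\subseteq\mathbb{Z}$, $A+A=\{a_1+a_2: a_1,a_2\in A\}$. For a positive integer $k$, $\mathcal A_k = \{A \subseteq [0, k-1] : 0 \in A \text{ and } k \notin A + A\}$. *)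

(* Defs.v *)
From HB Require Import structures.
From mathcomp Require Import all_boot all_order all_algebra.
From mathcomp Require Import all_classical all_reals all_analysis.
Set Implicit Arguments. Unset Strict Implicit. Unset Printing Implicit Defensive.
Import Order.TTheory GRing.Theory Num.Theory.

(* A gap set is a finite set G of naturals all below N, given as G : {set 'I_N}.
   The associated subset of N_0 is  Lambda = N_0 \ G.                          *)

Definition elem (N : nat) (G : {set 'I_N}) (n : nat) : bool :=
  [forall i in G, val i != n].

(* Lambda contains 0 and is closed under addition (its complement G is finite by
   construction).  Closure is only checked for a, b < N; for a >= N or b >= N
   the sum is >= N hence trivially in Lambda (see lemma is_numsgP). *)
Definition is_numsg (N : nat) (G : {set 'I_N}) : bool :=
  elem G 0 &&
  [forall a : 'I_N, forall b : 'I_N, elem G a ==> elem G b ==> elem G (a + b)].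

Lemma elem_ge (N : nat) (G : {set 'I_N}) n : N <= n -> elem G n.
Proof.
move=> Hn; apply/forall_inP => i _; apply/eqP => Hi.
by move: (ltn_ord i); rewrite Hi ltnNge Hn.
Qed.

Lemma is_numsgP (N : nat) (G : {set 'I_N}) :
  reflect (elem G 0 /\ forall a b, elem G a -> elem G b -> elem G (a + b))
          (is_numsg G).
Proof.
apply: (iffP andP) => [[H0 /forallP H] | [H0 H]]; split => //.
  move=> a b Ha Hb.
  case: (ltnP a N) => [ltaN|]; last by move=> le; apply: elem_ge; exact: leq_trans le (leq_addr _ _).
  case: (ltnP b N) => [ltbN|]; last by move=> le; apply: elem_ge; exact: leq_trans le (leq_addl _ _).
  by move: (H (Ordinal ltaN)) => /forallP /(_ (Ordinal ltbN)) /implyP /(_ Ha) /implyP /(_ Hb).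
by apply/forallP => a; apply/forallP => b; apply/implyP => Ha; apply/implyP => Hb; apply: H.
Qed.

Definition genus (N : nat) (G : {set 'I_N}) : nat := #|G|.

(* Frobenius number = largest gap (for a nonempty gap set) *)
Definition frobenius (N : nat) (G : {set 'I_N}) : nat := \max_(i in G) val i.

Lemma elem_pos_exists (N : nat) (G : {set 'I_N}) : exists n, (0 < n) && elem G n.
Proof. by exists N.+1; rewrite ltn0Sn /= elem_ge. Qed.

Definition multiplicity (N : nat) (G : {set 'I_N}) : nat :=
  ex_minn (elem_pos_exists G).

(* t_g = number of numerical semigroups of genus g with f < 3m.
   Every numerical semigroup of genus g has all its gaps <= 2g - 1 (standard:
   f <= 2g - 1), so it corresponds to exactly one gap set G : {set 'I_(2g)}. *)
Definition t (g : nat) : nat :=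
  #|[set G : {set 'I_(2 * g)} |
      [&& is_numsg G, genus G == g & frobenius G < 3 * multiplicity G]]|.

Definition in_sumset (k : nat) (A : {set 'I_k}) (n : nat) : bool :=
  [exists i in A, exists j in A, val i + val j == n].

Definition in_Ak (k : nat) (A : {set 'I_k}) : bool :=
  [exists i in A, val i == 0] && ~~ in_sumset A k.

Definition sumset_card (k : nat) (A : {set 'I_k}) : nat :=
  #|[set n : 'I_k.+1 | in_sumset A n]|.

Local Open Scope ring_scope.

Definition phi (R : realType) : R := (1 + Num.sqrt 5) / 2.

Definition inner_sum (R : realType) (k : nat) : R :=
  \sum_(A : {set 'I_k} | in_Ak A)
     phi R ^ (- (sumset_card A)%:Z + (#|A|)%:Z - k%:Z - 1).

(* Main.v *)
(* Sort the semigroups by their Frobenius number f.  Those with f < 2m are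
   arbitrary subsets of ]m, 2m[, hence are counted by the diagonal binomial sums
   sum_p C(p, g - p), i.e. by Fibonacci numbers; this gives phi / sqrt 5.  If
   f = 2m + k with 0 < k < m, put A = {x < k : m + x in Lambda} and
   C = (A + A) /\ [0, k]; then A is in A_k, and Lambda is determined by A and by
   the membership of the m - 1 - |C| slots in ]m + k, 2m[ and in
   [2m, 2m + k[ \ (2m + C), which is free.  Summing over m gives again a diagonal
   binomial sum, of index g - k - 2 - |C| + |A|, up to finitely many terms that
   vanish for g large.  The limit follows by dominated convergence over k.

   What remains is the convergence of the sum over k.  Let y = 1 / phi and let a be
   the least positive element of A (or k).  Record for 0 < x < k/2 whether x is in
   A, k - x is in A, or neither.  As a + A is contained in A + A, each x - a in A
   with x not in A, and each k - x in A with k - x + a not in A, puts an element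
   into C \ A.  So the weight y^(k + 1 + |C| - |A|) is at most a product of
   transfer weights along the progressions of difference a.  The transfer matrix has
   spectral radius < 1, and a progression starts in a state other than "x in A",
   because no element of ]0, a[ lies in A; so the sum over all A with a given a is
   at most .99^n with n = (k-1)/2, and sum_k k * .99^((k-1)/2) converges. *)
Require Import Defs.
From HB Require Import structures.
From mathcomp Require Import all_boot all_order all_algebra.
From mathcomp Require Import all_classical all_reals all_analysis.
From mathcomp Require Import zify ring lra.
From mathcomp Require Import fintype finset.
Set Implicit Arguments. Unset Strict Implicit. Unset Printing Implicit Defensive.
Import Order.TTheory GRing.Theory Num.Theory.
Import numFieldNormedType.Exports.

(** * Counting semigroups with f < 3m *)

Lemma elem_ord (N : nat) (G : {set 'I_N}) (i : 'I_N) : elem G i = (i \notin G).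
Proof.
apply/forall_inP/idP => [H|Hi j Hj].
  by apply/negP => /H /eqP.
by apply/eqP => /val_inj ji; move: Hi; rewrite -ji Hj.
Qed.

Lemma gap_lt (N : nat) (G : {set 'I_N}) (n : nat) : ~~ elem G n -> n < N.
Proof. by rewrite ltnNge; apply: contra => /(elem_ge G). Qed.

Lemma card_nat_pred (N : nat) (P : pred nat) :
  #|[set i : 'I_N | P i]| = \sum_(0 <= i < N) P i.
Proof.
rewrite cardsE -sum1_card big_mkcond /= big_mkord; apply: eq_bigr => i _.
by rewrite unfold_in /=; case: (P i).
Qed.

Lemma card_gaps (N : nat) (G : {set 'I_N}) :
  #|G| = \sum_(0 <= i < N) ~~ elem G i.
Proof.
rewrite -(card_nat_pred N (fun i => ~~ elem G i)).
by apply: eq_card => i; rewrite inE elem_ord negbK.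
Qed.

Lemma card_fibers (T : finType) (E : {set T}) (n : nat) (p : T -> nat) :
  (forall x, x \in E -> p x < n) ->
  #|E| = \sum_(0 <= i < n) #|[set x in E | p x == i]|.
Proof.
move=> Hp; rewrite -sum1_card.
under [RHS]eq_bigr => i _ do rewrite -sum1_card big_mkcond /=.
rewrite exchange_big big_mkcond /=; apply: eq_bigr => x _.
under eq_bigr => i _ do rewrite inE.
case: ifP => [xE|_]; last by rewrite big1.
rewrite (bigD1_seq (p x)) ?iota_uniq ?mem_index_iota ?Hp //= eqxx big1 // => i.
by rewrite eq_sym => /negbTE ->.
Qed.

(** Such a G is F together with an arbitrary subset of D: F holds the forced gaps, D the free
    positions. *)
Lemma card_draws_between (T : finType) (D F : {set T}) (g : nat) :
  [disjoint F & D] -> 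
  #|[set G : {set T} | (G :\: D == F) && (#|G| == g)]| =
  if #|F| <= g then 'C(#|D|, g - #|F|) else 0.
Proof.
move=> FD; case: leqP => Hg; last first.
  apply/eqP; rewrite cards_eq0; apply/eqP/setP => G; rewrite !inE; apply/negP.
  by case/andP => /eqP GF /eqP Gg; move: Hg; rewrite -Gg -GF ltnNge subset_leq_card ?subsetDl.
rewrite -cards_draws.
have FI : F :&: D = set0 by apply/eqP; rewrite setI_eq0.
have FD' : F :\: D = F by apply/setDidPl.
rewrite -[RHS](card_in_imset (f := fun B : {set T} => F :|: B)); last first.
  move=> B1 B2; rewrite !inE => /andP[B1D _] /andP[B2D _] E.
  have : (F :|: B1) :&: D = (F :|: B2) :&: D by rewrite E.
  by rewrite !setIUl FI !set0U (setIidPl B1D) (setIidPl B2D).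
apply: eq_card => G; rewrite !inE; apply/andP/imsetP => [[/eqP GF /eqP Gg]|[B]].
  exists (G :&: D); last by rewrite -GF setUC setID.
  by rewrite inE subsetIr -GF cardsD Gg; apply/eqP; have := subset_leq_card (subsetIl G D); lia.
rewrite inE => /andP[BD /eqP Bc] ->.
rewrite setDUl FD'; have/eqP -> : B :\: D == set0 by rewrite setD_eq0.
rewrite setU0 eqxx cardsU; split=> //.
have/eqP -> : F :&: B == set0 by rewrite -subset0 -FI setIS.
by rewrite cards0 Bc; apply/eqP; lia.
Qed.

Lemma multiplicityP (N : nat) (G : {set 'I_N}) (m : nat) :
  reflect [/\ 0 < m, elem G m & forall n, 0 < n < m -> ~~ elem G n]
          (multiplicity G == m).
Proof.
rewrite /multiplicity; case: ex_minnP => m0 /andP[m0_gt0 Hm0] Hmin.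
apply: (iffP eqP) => [<-|[Hm Em Hn]].
  split=> // n /andP[n0 nm]; apply/negP => En.
  by have := Hmin n; rewrite n0 En => /(_ isT); lia.
apply/eqP; rewrite eqn_leq Hmin ?Hm ?Em //= leqNgt; apply/negP => lt.
by have := Hn m0; rewrite m0_gt0 lt Hm0 => /(_ isT).
Qed.

Lemma frobenius_ltP (N : nat) (G : {set 'I_N}) (b : nat) : 0 < b ->
  reflect (forall n, ~~ elem G n -> n < b) (frobenius G < b).
Proof.
case: b => // b _; rewrite ltnS; apply: (iffP (bigmax_leqP _ _ _)) => H.
  move=> n Hn; case: (ltnP n N) => [lt|/(elem_ge G)]; last by rewrite (negbTE Hn).
  by apply: (H (Ordinal lt)); rewrite -[_ \in _]negbK -elem_ord.
by move=> i iG; rewrite -ltnS; apply: H; rewrite elem_ord iG.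
Qed.

Lemma frobeniusP (N : nat) (G : {set 'I_N}) (f : nat) : 0 < f ->
  reflect (~~ elem G f /\ forall n, f < n -> elem G n) (frobenius G == f).
Proof.
move=> f0; apply: (iffP eqP) => [Ef|[Hf Hn]].
  split; last first.
    move=> n Hn; apply/negPn/negP => Hgap.
    have : frobenius G < f.+1 by rewrite Ef.
    by move/(frobenius_ltP _ (ltn0Sn _)) => /(_ _ Hgap); lia.
  apply/negP => Hel; have : frobenius G < f; last by rewrite Ef ltnn.
  apply/frobenius_ltP => // n Hgap.
  have : frobenius G < f.+1 by rewrite Ef.
  move/(frobenius_ltP _ (ltn0Sn _)) => /(_ _ Hgap).
  by rewrite ltnS leq_eqVlt => /orP[/eqP nf|//]; move: Hgap; rewrite nf Hel.
apply/eqP; rewrite eqn_leq -ltnS; apply/andP; split.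
  apply/frobenius_ltP => // n Hgap; rewrite ltnS leqNgt; apply/negP => /Hn.
  by rewrite (negbTE Hgap).
rewrite leqNgt; apply/negP => /(frobenius_ltP _ f0) /(_ _ Hf).
by rewrite ltnn.
Qed.

(** * Semigroups with f < 2m *)

Definition Tset (g : nat) : {set {set 'I_(2 * g)}} :=
  [set G : {set 'I_(2 * g)} |
      [&& is_numsg G, genus G == g & frobenius G < 3 * multiplicity G]].

Lemma setD_eq_elem (N : nat) (G F D : {set 'I_N}) :
  (G :\: D == F) <-> (forall i : 'I_N, i \notin D -> elem G i = (i \notin F)) /\ [disjoint F & D].
Proof.
split=> [/eqP <-|[H FD]].
  split; last by rewrite disjoints_subset subsetDr.
  by move=> i iD; rewrite elem_ord !inE iD.
apply/eqP/setP => i; rewrite inE; case: (boolP (i \in D)) => iD /=.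
  by apply/esym/negbTE/negP => iF; have := disjointFr FD iF; rewrite iD.
by have := H i iD; rewrite elem_ord => /negb_inj.
Qed.

(** A sum of two nonzero elements is at least 2m, hence beyond all gaps, so membership in ]m, 2m[
    can be chosen freely. *)
Lemma Tset_short_fiber (g m : nat) : 0 < g -> 0 < m -> m <= g.+1 ->
  [set G in [set G in Tset g | frobenius G < 2 * multiplicity G] | multiplicity G == m] =
  [set G : {set 'I_(2 * g)} | (G :\: [set i : 'I_(2 * g) | m < i < 2 * m] == [set i : 'I_(2 * g)| 0 < i < m])
      && (#|G| == g)].
Proof.
move=> g0 m0 mg; apply/setP => G; rewrite !inE /genus.
apply/idP/idP.
  case/andP => /andP[/and3P[/is_numsgP [H0 Hadd] Gg _] Hf] /multiplicityP [_ Em Hm].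
  rewrite Gg andbT; apply/setD_eq_elem; split.
    move=> i; rewrite !inE => Hi.
    have [i0|i0] := posnP i; first by rewrite i0 H0.
    have [im|im] := ltnP i m; first by apply/negbTE/Hm; rewrite i0.
    have [E|nE] := eqVneq (i : nat) m; first by rewrite E Em.
    apply/negPn/negP => gi;
    have mE : multiplicity G = m by apply/eqP/multiplicityP; split.
    have m2 : 0 < 2 * m by lia.
    by move: Hf; rewrite mE => /(frobenius_ltP _ m2) /(_ _ gi); lia.
  by rewrite disjoints_subset; apply/subsetP => i; rewrite !inE; lia.
case/andP => /setD_eq_elem [HG FD] Gg.
have nonel n : 0 < n < m -> ~~ elem G n.
  move=> /andP[n0 nm]; have nN : n < 2 * g by lia.
  have := HG (Ordinal nN); rewrite !inE /= n0 nm /= => -> //.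
  lia.
have El n : (n == 0) || (n == m) || (2 * m <= n) -> elem G n.
  move=> Hn; case: (ltnP n (2 * g)) => [nN|]; last exact: elem_ge.
  by have := HG (Ordinal nN); rewrite !inE /= => ->; lia.
have gem n : 0 < n -> elem G n -> m <= n.
  by move=> n0 En; rewrite leqNgt; apply/negP => nm; have := nonel n; rewrite n0 nm En => /(_ isT).
have mE : multiplicity G = m.
  by apply/eqP/multiplicityP; split=> //; apply: El; rewrite eqxx orbT.
rewrite mE eqxx Gg !andbT andTb.
have Hf : frobenius G < 2 * m.
  apply/frobenius_ltP; first lia.
  by move=> n; apply: contraR; rewrite -leqNgt => Hn; apply: El; rewrite Hn orbT.
rewrite Hf andbT; apply/andP; split; last lia.
apply/is_numsgP; split; first by apply: El.
move=> a b Ea Eb.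
have [->//|a0] := posnP a; have [->|b0] := posnP b; first by rewrite addn0.
by apply: El; have := gem _ a0 Ea; have := gem _ b0 Eb; lia.
Qed.

Lemma card_nat_interval (N a b : nat) :
  #|[set i : 'I_N | a < i < b]| = minn b N - a.+1.
Proof.
rewrite (card_nat_pred _ (fun i => a < i < b)).
elim: N => [|N IHN]; first by rewrite big_geq // minn0.
rewrite big_nat_recr //= IHN; case: (ltnP a N) => ?; case: (ltnP N b) => ? /=; lia.
Qed.

Lemma card_short_fiber (g m : nat) : 0 < g -> 0 < m -> m <= g.+1 ->
  #|[set G in [set G in Tset g | frobenius G < 2 * multiplicity G] | multiplicity G == m]| =
  'C(m.-1, g - m.-1).
Proof.
move=> g0 m0 mg; rewrite Tset_short_fiber // card_draws_between; last first.
  by rewrite disjoints_subset; apply/subsetP => i; rewrite !inE; lia.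
rewrite !card_nat_interval.
have -> : minn m (2 * g) - 1 = m.-1 by lia.
case: leqP => H; last lia.
case: (leqP m g) => Hm; first by congr 'C(_, _); lia.
(* For m = g + 1 the interval ]m, 2m[ is cut off at 2g, but all g gaps lie below m, so both binomial
   coefficients are 1. *)
have -> : g - m.-1 = 0 by lia.
by rewrite !bin0.
Qed.

(** * Semigroups with f = 2m + k *)

(** [elem] is membership in the complement, so [~~ elem A i] says that the natural number i lies in
    A, which includes i < k. *)
Lemma in_sumsetP (k : nat) (A : {set 'I_k}) (n : nat) :
  reflect (exists i j, [/\ ~~ elem A i, ~~ elem A j & i + j = n]) (in_sumset A n).
Proof.
apply: (iffP exists_inP) => [[i iA /exists_inP [j jA /eqP ij]]|[i [j [iA jA ij]]]].
  by exists i, j; rewrite !elem_ord !negbK.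
have ltk := @gap_lt k A.
exists (Ordinal (ltk _ iA)); first by rewrite -[_ \in _]negbK -elem_ord.
apply/exists_inP; exists (Ordinal (ltk _ jA)); last by apply/eqP.
by rewrite -[_ \in _]negbK -elem_ord.
Qed.

Lemma in_AkP (k : nat) (A : {set 'I_k}) :
  reflect (~~ elem A 0 /\ ~~ in_sumset A k) (in_Ak A).
Proof.
apply: (iffP andP) => -[H1 H2]; split=> //.
  by rewrite negb_forall_in; apply/exists_inP; have/exists_inP [i iA Hi] := H1; exists i; rewrite ?negbK.
by move: H1; rewrite negb_forall_in => /exists_inP [i iA]; rewrite negbK => Hi; apply/exists_inP; exists i.
Qed.

Definition slice (N : nat) (G : {set 'I_N}) (m k : nat) : {set 'I_k} :=
  [set i : 'I_k | elem G (m + i)].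

Lemma elem_slice (N : nat) (G : {set 'I_N}) (m k n : nat) : n < k ->
  elem (slice G m k) n = ~~ elem G (m + n).
Proof. by move=> nk; rewrite -[n]/(val (Ordinal nk)) elem_ord inE. Qed.

(* For f = 2m + k and A = slice G m k, every n satisfying neither [forced_gap] nor
   [free_slot] is in Lambda. *)
Definition forced_gap (k : nat) (A : {set 'I_k}) (m n : nat) : bool :=
  [|| 0 < n < m, (m <= n <= m + k) && elem A (n - m) | n == 2 * m + k].

Definition free_slot (k : nat) (A : {set 'I_k}) (m n : nat) : bool :=
  (m + k < n < 2 * m) || ((2 * m <= n < 2 * m + k) && ~~ in_sumset A (n - 2 * m)).

(** m in Lambda puts 0 into A, and i + j = k with i, j in A would put (m + i) + (m + j) = f into
    Lambda. *)
Lemma numsg_slice_in_Ak (N : nat) (G : {set 'I_N}) (m k : nat) : 0 < k ->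
  is_numsg G -> multiplicity G = m -> frobenius G = 2 * m + k ->
  in_Ak (slice G m k).
Proof.
move=> k0 /is_numsgP [_ Gadd] /eqP /multiplicityP [m0 Em _] /eqP.
move=> /frobeniusP -/(_ ltac:(lia)) [Hf _].
apply/in_AkP; split; first by rewrite elem_slice // addn0 negbK.
apply/in_sumsetP => -[i [j [iA jA ij]]]; move/negP: Hf; apply.
have ltk := @gap_lt k (slice G m k).
have := ltk _ iA; have := ltk _ jA => jk ik.
move: iA jA; rewrite !elem_slice // !negbK => iA jA.
by have := Gadd _ _ iA jA; rewrite addnACA ij addnn mul2n.
Qed.

(** Any choice of the free slots is closed under addition: a sum of two nonzero elements exceeds f,
    or it is 2m + c with c in A + A and c < k, which is neither a forced gap nor a free slot. *)
Lemma Tset_long_fiber (g m k : nat) (A : {set 'I_k}) :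
  0 < k -> k < m -> in_Ak A -> 2 * m + k < 2 * g ->
  [set G in Tset g | [&& multiplicity G == m, frobenius G == 2 * m + k & slice G m k == A]] =
  [set G : {set 'I_(2 * g)} | (G :\: [set i : 'I_(2 * g) | free_slot A m i] == [set i : 'I_(2 * g)| forced_gap A m i])
      && (#|G| == g)].
Proof.
move=> k0 km /in_AkP [A0 Ak] mkg; apply/setP => G; rewrite !inE /genus.
have ltk := @gap_lt k A.
have f0 : 0 < 2 * m + k by lia.
apply/idP/idP.
  case/andP => /and3P[/is_numsgP [H0 Hadd] Gg _].
  case/and3P => /multiplicityP [m0 Em Hm] /(frobeniusP _ f0) [Ef Hf] /eqP GA.
  rewrite Gg andbT; apply/setD_eq_elem; split.
    move=> i; rewrite !inE /free_slot /forced_gap negb_or => /andP[Hi1 Hi2].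
    have [i0|i0] /= := posnP i.
      rewrite i0 H0; have -> : (m <= 0) = false by lia.
      by rewrite /=; lia.
    have [im|im] /= := ltnP i m; first by apply/negbTE/Hm; rewrite i0.
    have [imk|imk] /= := leqP i (m + k).
      have -> : (i == 2 * m + k :> nat) = false by lia.
      (* m + k is a gap, since m + (m + k) = f; [elem A k] holds because k is out of range. *)
      rewrite orbF; have [Eik|nik] := eqVneq (i : nat) (m + k).
        rewrite Eik addKn [elem A k]elem_ge //; apply/negbTE/negP => mkG.
        by have := Hadd _ _ Em mkG; rewrite addnA addnn -mul2n (negbTE Ef).
      by rewrite -GA elem_slice ?negbK; [congr elem; lia | lia].
    have i2m : 2 * m <= i by move: Hi1; rewrite imk /= -leqNgt.
    have [Ei|Ei] := eqVneq (i : nat) (2 * m + k); first by rewrite Ei (negbTE Ef).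
    have [Hik|Hik] := ltnP (2 * m + k) i; first by rewrite Hf.
    have {}Hik : i < 2 * m + k by rewrite ltn_neqAle Ei.
    move: Hi2; rewrite i2m Hik /= negbK => /in_sumsetP [a [b [aA bA ab]]].
    have ak := ltk _ aA; have bk := ltk _ bA.
    move: aA bA; rewrite -GA !elem_slice // !negbK => aA bA.
    by have := Hadd _ _ aA bA; have -> : m + a + (m + b) = i by lia.
  rewrite disjoints_subset; apply/subsetP => i; rewrite !inE /forced_gap /free_slot.
  case/or3P => [H|/andP[H1 H2]|/eqP ->]; [lia| lia|lia].
case/andP => /setD_eq_elem [HG _] Gg.
have HGn n : ~~ free_slot A m n -> elem G n = ~~ forced_gap A m n.
  case: (ltnP n (2 * g)) => [nN|nN] nf; first by have := HG (Ordinal nN); rewrite !inE; apply.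
  by rewrite elem_ge //; apply/esym; rewrite /forced_gap; lia.
have nonel n : 0 < n < m -> ~~ elem G n.
  by move=> nm; rewrite HGn /free_slot /forced_gap ?nm //; lia.
have El n : elem G n = ~~ forced_gap A m n \/ m + k < n < 2 * m + k.
  case: (boolP (free_slot A m n)) => [|/HGn]; last by left.
  by rewrite /free_slot => ?; right; lia.
have gem n : 0 < n -> elem G n -> m <= n.
  by move=> n0 En; rewrite leqNgt; apply/negP => nm; have := nonel n; rewrite n0 nm En => /(_ isT).
have E0 : elem G 0.
  by case: (El 0) => [->|]; rewrite ?ltn0 // /forced_gap; lia.
have Em : elem G m.
  case: (El m) => [->|]; last lia.
  by rewrite /forced_gap subnn (negbTE A0) andbF; lia.
have mE : multiplicity G == m by apply/multiplicityP; split=> //; lia.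
have fE : frobenius G == 2 * m + k.
  apply/frobeniusP => //; split.
    case: (El (2 * m + k)) => [->|]; last lia.
    by rewrite /forced_gap eqxx !orbT.
  move=> n fn; case: (El n) => [->|]; last lia.
  by rewrite /forced_gap; lia.
have Ein n : m <= n <= m + k -> elem G n = ~~ elem A (n - m).
  move=> Hn; case: (El n) => [->|]; last lia.
  rewrite /forced_gap Hn /=; have -> : (n < m) = false by lia.
  have -> : (n == 2 * m + k) = false by lia.
  by rewrite andbF orbF.
have sE : slice G m k == A.
  apply/eqP/setP => i; rewrite inE Ein; last by have := ltn_ord i; lia.
  by rewrite addKn elem_ord negbK.
rewrite mE fE sE (eqP mE) (eqP fE) Gg /= !andbT; apply/andP; split; last lia.
apply/is_numsgP; split=> // a b Ea Eb.
have [->//|a0] := posnP a; have [->|b0] := posnP b; first by rewrite addn0.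
have ma := gem _ a0 Ea; have mb := gem _ b0 Eb.
have [abf|abf] := leqP (a + b) (2 * m + k); last first.
  case: (El (a + b)) => [->|]; last lia.
  by rewrite /forced_gap; lia.
(* Both a - m and b - m are at most k, as a, b >= m and a + b <= 2m + k; hence both lie in A. *)
have sab : in_sumset A (a + b - 2 * m).
  apply/in_sumsetP; exists (a - m), (b - m); split; last lia.
    by rewrite -Ein // ; lia.
  by rewrite -Ein //; lia.
have nf : ~~ free_slot A m (a + b).
  by rewrite /free_slot sab andbF; lia.
rewrite HGn // /forced_gap.
have -> : (a + b <= m + k) = false by lia.
have -> : (a + b == 2 * m + k) = false; last by rewrite andbF /= orbF; lia.
apply/negbTE/eqP => E; move: sab; rewrite E addKn.
by rewrite (negbTE Ak).
Qed.

Lemma sum_nat_interval (N a b : nat) :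
  \sum_(0 <= i < N) (a < i < b) = minn b N - a.+1.
Proof. by rewrite -(card_nat_interval N a b) (card_nat_pred N (fun i => a < i < b)). Qed.

Lemma sum_nat_shift (N m K : nat) (P : pred nat) : m + K <= N ->
  \sum_(0 <= i < N) ((m <= i < m + K) && P (i - m)) = \sum_(0 <= j < K) P j.
Proof.
move=> H; rewrite (big_cat_nat _ (n := m)) //=; last lia.
rewrite (big_cat_nat _ (n := m + K) (m := m)) //=; try lia.
rewrite (_ : \sum_(0 <= i < m) _ = 0) ?add0n; last first.
  by rewrite big_nat big1 // => i Hi; rewrite (_ : m <= i = false); lia.
rewrite (_ : \sum_(m + K <= i < N) _ = 0) ?addn0; last first.
  by rewrite big_nat big1 // => i Hi; rewrite (_ : i < m + K = false) ?andbF; lia.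
rewrite -{1}[m]add0n big_addn addKn; apply: eq_big_nat => i Hi.
by rewrite addnK; have -> : (m <= i + m < m + K) by lia.
Qed.

Lemma sum_nat_negb (K : nat) (P : pred nat) :
  \sum_(0 <= j < K) P j + \sum_(0 <= j < K) ~~ P j = K.
Proof.
rewrite -big_split /= (eq_bigr (fun=> 1)) ?sum_nat_const_nat ?muln1 ?subn0 // => i _.
by case: (P i).
Qed.

(** There are m - 1 gaps below m, k + 1 - |A| in [m, m + k], and f itself. *)
Lemma sum_forced_gap (N k m : nat) (A : {set 'I_k}) : 0 < k -> k < m -> 2 * m + k < N ->
  \sum_(0 <= i < N) forced_gap A m i + #|A| = (m + k).+1.
Proof.
move=> k0 km mN.
under eq_bigr => i _.
  have -> : forced_gap A m i =
    (0 < i < m) + ((m <= i < m + k.+1) && elem A (i - m)) + ((2 * m + k).-1 < i < (2 * m + k).+1) :> nat.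
    rewrite /forced_gap addnS ltnS.
    by case: (elem A _); rewrite ?andbT ?andbF; lia.
  over.
rewrite !big_split /= !sum_nat_interval sum_nat_shift; last lia.
have := sum_nat_negb k (elem A); rewrite -card_gaps big_nat_recr //= (elem_ge A (leqnn k)).
by lia.
Qed.

(** There are m - 1 - k slots in ]m + k, 2m[ and k - |C| from 2m on; as k is not in A + A, all of C
    lies below k. *)
Lemma sum_free_slot (N k m : nat) (A : {set 'I_k}) : 0 < k -> k < m -> 2 * m + k < N ->
  ~~ in_sumset A k ->
  \sum_(0 <= i < N) free_slot A m i + sumset_card A = m.-1.
Proof.
move=> k0 km mN Ak.
under eq_bigr => i _.
  have -> : free_slot A m i =
    (m + k < i < 2 * m) + ((2 * m <= i < 2 * m + k) && ~~ in_sumset A (i - 2 * m)) :> nat.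
    rewrite /free_slot.
    by case: (in_sumset A _); rewrite ?andbT ?andbF; lia.
  over.
rewrite !big_split /= !sum_nat_interval.
rewrite (@sum_nat_shift _ _ _ (fun j => ~~ in_sumset A j)); last lia.
rewrite /sumset_card (card_nat_pred k.+1 (in_sumset A)) big_nat_recr //= (negbTE Ak).
have := sum_nat_negb k (in_sumset A); lia.
Qed.

Lemma card_long_fiber (g m k : nat) (A : {set 'I_k}) :
  0 < k -> k < m -> in_Ak A -> 2 * m + k < 2 * g ->
  #|[set G in Tset g | [&& multiplicity G == m, frobenius G == 2 * m + k & slice G m k == A]]| =
  if (m + k).+1 <= g + #|A| then 'C(m.-1 - sumset_card A, g + #|A| - (m + k).+1) else 0.
Proof.
move=> k0 km AA mkg; have [_ Ak] := in_AkP _ AA.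
rewrite Tset_long_fiber // card_draws_between; last first.
  rewrite disjoints_subset; apply/subsetP => i; rewrite !inE /forced_gap /free_slot.
  by case: (elem A _); rewrite ?andbT ?andbF; lia.
rewrite (card_nat_pred _ (forced_gap A m)) (card_nat_pred _ (free_slot A m)).
have := sum_forced_gap A k0 km mkg; have := sum_free_slot k0 km mkg Ak.
set F := \sum_(0 <= i < _) forced_gap A m i; set D := \sum_(0 <= i < _) _ => HD HF.
rewrite (_ : (F <= g) = ((m + k).+1 <= g + #|A|)); last by lia.
by case: ifP => // H; congr 'C(_, _); lia.
Qed.

(** For 2m + k >= 2g the fiber is empty, since ['I_(2 * g)] has no room for the gap f. *)
Lemma card_long_fiber_le (g m k : nat) (A : {set 'I_k}) :
  0 < k -> k < m -> in_Ak A -> 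
  #|[set G in Tset g | [&& multiplicity G == m, frobenius G == 2 * m + k & slice G m k == A]]| <=
  if (m + k).+1 <= g + #|A| then 'C(m.-1 - sumset_card A, g + #|A| - (m + k).+1) else 0.
Proof.
move=> k0 km AA; case: (ltnP (2 * m + k) (2 * g)) => H; first by rewrite card_long_fiber.
rewrite (_ : #|_| = 0) //; apply/eqP; rewrite cards_eq0; apply/eqP/setP => G.
rewrite [RHS]inE inE; apply/negP => /andP[_ /and3P[_ /frobeniusP HF _]].
by have [|] := HF; [lia | rewrite elem_ge].
Qed.

(** At most one of i and k - i is in A; summing over 0 <= i <= k counts A twice. *)
Lemma card_Ak_le (k : nat) (A : {set 'I_k}) : in_Ak A -> 2 * #|A| <= k.+1.
Proof.
case/in_AkP => A0 Ak; rewrite card_gaps mul2n -addnn.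
rewrite [X in X + _](_ : _ = \sum_(0 <= i < k.+1) ~~ elem A i); last first.
  by rewrite [RHS]big_nat_recr //= elem_ge // addn0.
rewrite [X in _ + X](_ : _ = \sum_(0 <= i < k.+1) ~~ elem A (k - i)); last first.
  by rewrite [RHS]big_nat_rev /= big_nat_recr //= -[LHS]addn0; congr (_ + _);
    [apply: eq_big_nat => i Hi; congr (nat_of_bool (~~ elem A _)); lia
    |rewrite elem_ge //; lia].
rewrite -big_split /= -[leqRHS]subn0 -[leqRHS]muln1 -sum_nat_const_nat.
rewrite !big_nat; apply: leq_sum => i Hi; case: (boolP (elem A i)) => iA /=; first exact: leq_b1.
case: (boolP (elem A (k - i))) => // kiA; case/in_sumsetP: Ak.
by exists i, (k - i); split=> //; lia.
Qed.

(** * Diagonal binomial sums and the formula for [t g] *)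

(** The Fibonacci number of index h + 1, where F_1 = F_2 = 1. *)
Definition diagonal_sum (h : nat) : nat := \sum_(0 <= p < h.+1) 'C(p, h - p).

Lemma diagonal_sumSS (h : nat) :
  diagonal_sum h.+2 = diagonal_sum h.+1 + diagonal_sum h.
Proof.
rewrite /diagonal_sum big_nat_recl // bin0n add0n big_nat_recr //= subnn bin0.
rewrite [\sum_(0 <= p < h.+2) _]big_nat_recr //= subnn bin0 addnAC; congr (_ + _).
rewrite -big_split /=; apply: eq_big_nat => p Hp.
by rewrite subSS subSn ?binS; last lia.
Qed.

Lemma sumset_card_le (k : nat) (A : {set 'I_k}) : in_Ak A -> sumset_card A <= k.
Proof.
case/in_AkP => _ Ak; rewrite /sumset_card (card_nat_pred k.+1 (in_sumset A)).
rewrite big_nat_recr //= (negbTE Ak) addn0; have := sum_nat_negb k (in_sumset A); lia.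
Qed.

(** The numbers 1, ..., m - 1 are gaps, and there are only g gaps. *)
Lemma Tset_mult_le (g : nat) (G : {set 'I_(2 * g)}) : 0 < g ->
  G \in Tset g -> multiplicity G <= g.+1.
Proof.
move=> g0; rewrite inE => /and3P[_ /eqP Gg _]; rewrite leqNgt; apply/negP => Hm.
have /multiplicityP [_ _ gap] := eqxx (multiplicity G).
have gN : g.+1 < 2 * g.
  by rewrite ltnNge; apply/negP => /(elem_ge G); apply/negP/gap; lia.
have : #|[set i : 'I_(2 * g) | 0 < i < g.+2]| <= #|G|.
  apply: subset_leq_card; apply/subsetP => i; rewrite inE => Hi.
  by rewrite -[_ \in _]negbK -elem_ord; apply: gap; lia.
by rewrite card_nat_interval; move: Gg; rewrite /genus; lia.
Qed.

Lemma card_short (g : nat) : 0 < g ->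
  #|[set G in Tset g | frobenius G < 2 * multiplicity G]| = diagonal_sum g.
Proof.
move=> g0; rewrite (@card_fibers _ _ g.+2 (fun G => multiplicity G)); last first.
  by move=> G; rewrite inE => /andP[/(Tset_mult_le g0)].
rewrite big_nat_recl // (_ : #|_| = 0) ?add0n; last first.
  apply/eqP; rewrite cards_eq0; apply/eqP/setP => G; rewrite [RHS]inE inE.
  by apply/negP => /andP[_ /multiplicityP []].
rewrite /diagonal_sum !big_nat; apply: eq_bigr => p Hp.
by rewrite card_short_fiber // ltnS.
Qed.

Definition long_count (g k : nat) (A : {set 'I_k}) : nat :=
  #|[set G in Tset g | (frobenius G == 2 * multiplicity G + k)
                        && (slice G (multiplicity G) k == A)]|.

(** The sum starts at m = k + 1 because f < 3m forces k < m. *)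
Lemma long_count_fibers (g k : nat) (A : {set 'I_k}) : 0 < g ->
  long_count g A = \sum_(k.+1 <= m < g.+2)
    #|[set G in Tset g | [&& multiplicity G == m, frobenius G == 2 * m + k & slice G m k == A]]|.
Proof.
move=> g0; rewrite /long_count (@card_fibers _ _ g.+2 (fun G => multiplicity G)); last first.
  by move=> G; rewrite inE => /andP[/(Tset_mult_le g0)].
have E m : [set x in [set G in Tset g | (frobenius G == 2 * multiplicity G + k)
               & (slice G (multiplicity G) k == A)] | multiplicity x == m] =
   [set G in Tset g | [&& multiplicity G == m, frobenius G == 2 * m + k & slice G m k == A]].
  apply/setP => G; rewrite !inE; case: (eqVneq (multiplicity G) m) => [->|_]; by rewrite ?andbT ?andbF //=.
under eq_bigr => m _ do rewrite E.
have [kg|gk] := leqP k.+1 g.+2; last first.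
  rewrite [RHS]big_geq; last lia.
  rewrite big_nat big1 // => m Hm; apply/eqP; rewrite cards_eq0; apply/eqP/setP => G.
  rewrite [RHS]inE !inE; apply/negP => /andP[/and3P[_ _ HG] /and3P[/eqP mE /eqP fE _]].
  by move: HG; rewrite mE fE; lia.
rewrite (big_cat_nat _ (n := k.+1)) //= (_ : \sum_(0 <= i < k.+1) _ = 0) //.
rewrite big_nat big1 // => m Hm; apply/eqP; rewrite cards_eq0; apply/eqP/setP => G.
rewrite [RHS]inE !inE; apply/negP => /andP[/and3P[_ _ HG] /and3P[/eqP mE /eqP fE _]].
by move: HG; rewrite mE fE; lia.
Qed.

Lemma card_long (g : nat) : 0 < g ->
  #|[set G in Tset g | ~~ (frobenius G < 2 * multiplicity G)]| =
  \sum_(1 <= k < g.+1) \sum_(A : {set 'I_k} | in_Ak A) long_count g A.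
Proof.
move=> g0; rewrite (@card_fibers _ _ g.+1 (fun G => frobenius G - 2 * multiplicity G)); last first.
  move=> G; rewrite inE => /andP[GT]; have := Tset_mult_le g0 GT.
  by move: GT; rewrite inE => /and3P[_ _]; lia.
(* No semigroup has f = 2m, as m + m lies in Lambda; so the sum starts at k = 1. *)
rewrite big_ltn // (_ : #|_| = 0) ?add0n; last first.
  apply/eqP; rewrite cards_eq0; apply/eqP/setP => G; rewrite [RHS]inE !inE.
  apply/negP => /andP[/andP[/and3P[/is_numsgP [_ Gadd] _ _] H1] H2].
  have /multiplicityP [m0 Em _] := eqxx (multiplicity G).
  have fE : frobenius G == 2 * multiplicity G by lia.
  have f0 : 0 < 2 * multiplicity G by lia.
  by move/(frobeniusP _ f0): fE => [/negP []]; rewrite [2 * multiplicity G]mul2n -addnn Gadd.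
rewrite !big_nat; apply: eq_bigr => k /andP[k0 _]; rewrite -sum1_card.
rewrite (partition_big (fun G : {set 'I_(2 * g)} => slice G (multiplicity G) k) (@in_Ak k)) /=.
  apply: eq_bigr => A _; rewrite /long_count -sum1_card; apply: eq_bigl => G.
  by rewrite !inE; case: (slice _ _ _ == _); rewrite ?andbT ?andbF //; lia.
move=> G; rewrite !inE => /andP[/andP[/and3P[HG _ _] H1] H2].
by apply: numsg_slice_in_Ak => //; lia.
Qed.

Lemma t_decomposition (g : nat) : 0 < g ->
  t g = diagonal_sum g + \sum_(1 <= k < g.+1) \sum_(A : {set 'I_k} | in_Ak A) long_count g A.
Proof.
move=> g0; rewrite -card_short // -card_long // /t -/(Tset g).
rewrite -(cardsID [set G : {set 'I_(2 * g)} | frobenius G < 2 * multiplicity G] (Tset g)).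
by congr (_ + _); apply: eq_card => G; rewrite !inE // andbC.
Qed.

(** Substitute p = m - 1 - c, so that h - p = g + a - (m + k + 1). *)
Lemma sum_binomial_reindex (g k a c h : nat) : a <= k -> c <= k ->
  h + (k + 2 + c) = g + a ->
  \sum_(k.+1 <= m < g.+2)
    (if (m + k).+1 <= g + a then 'C(m.-1 - c, g + a - (m + k).+1) else 0)
  = \sum_(k - c <= p < h.+1) 'C(p, h - p).
Proof.
move=> ak ck Eh; have {1}-> : k.+1 = (k - c) + c.+1 by lia.
rewrite big_addn; have [Hh|Hh] := leqP (k - c) h.+1; last first.
  rewrite [RHS]big_geq; last lia.
  by rewrite big_nat big1 // => p Hp; case: ifP => // ?; lia.
rewrite (big_cat_nat _ (n := h.+1)) //=; last lia.
rewrite (_ : \sum_(h.+1 <= i < _) _ = 0) ?addn0; last first.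
  by rewrite big_nat big1 // => p Hp; case: ifP => // ?; lia.
apply: eq_big_nat => p Hp; case: ifP => ?; last lia.
by congr 'C(_, _); lia.
Qed.

Lemma sum_binomial_eq0 (g k a c : nat) : c <= k -> (k + 2 + c <= g + a) = false ->
  \sum_(k.+1 <= m < g.+2)
    (if (m + k).+1 <= g + a then 'C(m.-1 - c, g + a - (m + k).+1) else 0) = 0.
Proof.
by move=> ck H; rewrite big_nat big1 // => m Hm; case: ifP => // ?; lia.
Qed.

Lemma card_ord_set_le (k : nat) (A : {set 'I_k}) : #|A| <= k.
Proof. by rewrite -[leqRHS]card_ord max_card. Qed.

Lemma long_count_le (g k : nat) (A : {set 'I_k}) : 0 < g -> 0 < k -> in_Ak A ->
  long_count g A <= if k + 2 + sumset_card A <= g + #|A| then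
    diagonal_sum (g + #|A| - (k + 2 + sumset_card A)) else 0.
Proof.
move=> g0 k0 AA; rewrite long_count_fibers //.
apply: (@leq_trans (\sum_(k.+1 <= m < g.+2)
    (if (m + k).+1 <= g + #|A| then 'C(m.-1 - sumset_card A, g + #|A| - (m + k).+1) else 0))).
  by rewrite !big_nat; apply: leq_sum => m /andP[km _]; apply: card_long_fiber_le.
case: ifP => H; last by rewrite (sum_binomial_eq0 (sumset_card_le AA) H).
rewrite (sum_binomial_reindex (card_ord_set_le A) (sumset_card_le AA) (subnK H)).
rewrite /diagonal_sum; set h := g + _ - _; have [Hh|Hh] := leqP (k - sumset_card A) h.+1; last by rewrite big_geq //; lia.
by rewrite [leqRHS](big_cat_nat _ (n := k - sumset_card A)) //= leq_addl.
Qed.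

Lemma long_count_eq (g k : nat) (A : {set 'I_k}) : 0 < k -> 4 * k + 2 <= g -> in_Ak A ->
  long_count g A = diagonal_sum (g + #|A| - (k + 2 + sumset_card A)).
Proof.
move=> k0 kg AA; rewrite long_count_fibers; last lia.
have ck := sumset_card_le AA; have a2 := card_Ak_le AA.
transitivity (\sum_(k.+1 <= m < g.+2)
    (if (m + k).+1 <= g + #|A| then 'C(m.-1 - sumset_card A, g + #|A| - (m + k).+1) else 0)).
  rewrite !big_nat; apply: eq_bigr => m /andP[km _].
  case: (ltnP (2 * m + k) (2 * g)) => H; first exact: card_long_fiber.
  (* From 2|A| <= k + 1 and m + k + 1 <= g + |A| follows 2m + k < 2g; so beyond that range the upper
     bound is 0 as well. *)
  have aux a : 2 * a <= k.+1 -> (m + k).+1 <= g + a -> False by lia.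
  by apply/eqP; rewrite eqn_leq card_long_fiber_le //=; case: ifP => // /(aux _ a2).
have H : k + 2 + sumset_card A <= g + #|A| by lia.
rewrite (sum_binomial_reindex (card_ord_set_le A) ck (subnK H)).
(* For p < k - |C| this gives h - p > p, so the missing initial terms of the diagonal sum are 0. *)
have kh : 2 * k <= g + #|A| - (k + 2 + sumset_card A) by lia.
move: kh; set h := g + _ - _ => kh; rewrite /diagonal_sum.
rewrite [RHS](big_cat_nat _ (n := k - sumset_card A)) //=; last lia.
rewrite (_ : \sum_(0 <= i < _) _ = 0) //.
by rewrite big_nat big1 // => p Hp; rewrite bin_small //; lia.
Qed.

Local Open Scope ring_scope.

(** * Convergence of the sum over k *)

(* A state of x is the pair (x \in A, k - x \in A); [s] is the state of x - a and
   [s'] that of x. *)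
Definition pair_cost (s s' : bool * bool) : nat := (s.1 && ~~ s'.1) + (s'.2 && ~~ s.2).

(* [l] lists the states of x - 1, x - 2, ..., 1, where x = (size l).+1.  The default
   value (true, false) of [nth] is the state of 0. *)
Definition step_weight (R : realType) (y : R) (a : nat) (l : seq (bool * bool)) (s : bool * bool) : R :=
  if ((size l).+1 < a)%N then (~~ s.1)%:R * y ^+ 2
  else y ^+ (2 + pair_cost (nth (true, false) l a.-1) s).

Fixpoint path_weight (R : realType) (y : R) (a : nat) (l : seq (bool * bool)) : R :=
  if l is s :: l' then step_weight y a l' s * path_weight y a l' else 1.

(** The state (true, true) is absent, since x and k - x cannot both lie in A. *)
Definition pair_states : seq (bool * bool) := [:: (false, false); (true, false); (false, true)].

Fixpoint state_words (n : nat) : seq (seq (bool * bool)) :=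
  if n is n'.+1 then [seq s :: l | l <- state_words n', s <- pair_states] else [:: [::]].

(* A supersolution for the transfer matrix: one step multiplies it by at most .99
   (the Perron eigenvalue is about 0.941).  The value at the default
   state (true, false) is 1, which makes the start of a progression uniform with the
   later steps. *)
Definition potential (R : realType) (s : bool * bool) : R :=
  match s with
  | (false, false) => 116 / 100
  | (false, true) => 136 / 100
  | _ => 1
  end.

Lemma potential_ge1 (R : realType) (s : bool * bool) : 1 <= potential R s.
Proof. by case: s => [[] []] /=; lra. Qed.

Lemma step_weight_ge0 (R : realType) (y : R) a l s : 0 <= y -> 0 <= step_weight y a l s.
Proof.
move=> y0; rewrite /step_weight; case: ifP => _; last exact: exprn_ge0.
by rewrite mulr_ge0 ?ler0n ?exprn_ge0.
Qed.

Lemma path_weight_ge0 (R : realType) (y : R) a l : 0 <= y -> 0 <= path_weight y a l.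
Proof. by move=> y0; elim: l => //= s l IHl; rewrite mulr_ge0 ?step_weight_ge0. Qed.

Lemma step_potential_le (R : realType) (y : R) (a : nat) (l : seq (bool * bool)) :
  y ^+ 2 = 1 - y -> 618 / 1000 < y < 6181 / 10000 -> (0 < a)%N ->
  \sum_(s <- pair_states) step_weight y a l s * potential R s
    <= 99 / 100 * potential R (nth (true, false) l a.-1).
Proof.
move=> y2 /andP[y_gt y_lt] a0.
(* By y^2 = 1 - y all powers become affine in y, so each predecessor state leaves a linear
   inequality on the short interval. *)
have y3 : y ^+ 3 = 2 * y - 1 by move: (congr1 (fun z => y * z) y2) => /=; lra.
have y4 : y ^+ 4 = 2 - 3 * y by move: (congr1 (fun z => z * z) y2) => /=; lra.
rewrite /pair_states !big_cons big_nil /step_weight.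
case: ltnP => la.
  (* Below a only the two states with x not in A survive; their total 2.52 y^2 is compared with the
     potential 1 of the default state. *)
  rewrite nth_default /=; last lia.
  rewrite y2; lra.
by case: (nth _ _ _) => [[] []]; rewrite /pair_cost /= ?addn0 ?addn1 ?add0n ?y2 ?y3 ?y4; lra.
Qed.

(* The product runs over the last [a] states, exactly those that still influence
   later steps. *)
Lemma sum_path_weight_potential (R : realType) (y : R) (a n : nat) :
  y ^+ 2 = 1 - y -> 618 / 1000 < y < 6181 / 10000 -> (0 < a)%N ->
  \sum_(l <- state_words n) path_weight y a l * \prod_(i < a) potential R (nth (true, false) l i)
    <= (99 / 100) ^+ n.
Proof.
move=> y2 y_bd a0; have y0 : 0 <= y by have /andP[] := y_bd; lra.
elim: n => [|n IHn].
  by rewrite big_seq1 /= big1 ?mul1r // => i _; rewrite nth_nil.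
rewrite exprS; apply: le_trans (ler_wpM2l _ IHn); last lra.
rewrite -[state_words n.+1]/[seq s :: l | l <- state_words n, s <- pair_states].
rewrite big_allpairs_dep mulr_sumr; apply: ler_sum => l _.
case: a a0 {IHn} => // a a0.
(* Prepending s shifts the window: s enters, and the state at distance a from it leaves, which is
   its predecessor in the progression. [V] collects the states common to both windows. *)
rewrite [in leRHS]big_ord_recr /=.
set V := \prod_(i < a) _.
under eq_bigr => s _.
  rewrite big_ord_recl /= -/V.
  rewrite (_ : _ * _ = (path_weight y a.+1 l * V) * (step_weight y a.+1 l s * potential R s)).
    over.
  by rewrite [in LHS]mulrCA; ring.
rewrite -mulr_sumr.
have V0 : 0 <= V by apply: prodr_ge0 => i _; apply: le_trans (potential_ge1 R _); lra.
apply: le_trans (ler_wpM2l _ (step_potential_le l y2 y_bd a0)) _.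
  by rewrite mulr_ge0 ?path_weight_ge0.
by rewrite /= le_eqVlt; apply/orP; left; apply/eqP; ring.
Qed.

Lemma sum_path_weight (R : realType) (y : R) (a n : nat) :
  y ^+ 2 = 1 - y -> 618 / 1000 < y < 6181 / 10000 -> (0 < a)%N ->
  \sum_(l <- state_words n) path_weight y a l <= (99 / 100) ^+ n.
Proof.
move=> y2 y_bd a0; apply: le_trans (sum_path_weight_potential n y2 y_bd a0).
have y0 : 0 <= y by have /andP[] := y_bd; lra.
apply: ler_sum => l _; apply: ler_peMr; first exact: path_weight_ge0.
elim/big_ind: _ => // [u v u1 v1|i _]; last exact: potential_ge1.
by rewrite -[1]mulr1 ler_pM.
Qed.

(** * Encoding A as a word of states *)

Fixpoint encode (P : pred nat) (k n : nat) : seq (bool * bool) :=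
  if n is n'.+1 then (P n, P (k - n)%N) :: encode P k n' else [::].

Lemma size_encode P k n : size (encode P k n) = n.
Proof. by elim: n => //= n ->. Qed.

Lemma nth_encode P k n i x0 : (i < n)%N ->
  nth x0 (encode P k n) i = (P (n - i)%N, P (k - (n - i))%N).
Proof. by elim: n i => // n IHn [|i] //= ltin; rewrite IHn. Qed.

Lemma path_weight_encode (R : realType) (y : R) (P : pred nat) (k a n : nat) :
  (0 < a)%N -> (forall x, (0 < x < a)%N -> ~~ P x) -> P 0%N -> ~~ P k -> (n <= k)%N ->
  path_weight y a (encode P k n) =
  y ^+ (2 * n + \sum_(a <= x < n.+1)
        ((P (x - a) && ~~ P x) + (P (k - x) && ~~ P (k - x + a)))%N).
Proof.
move=> a0 Pa P0 Pk; elim: n => [|n IHn] nk; first by rewrite big_geq.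
rewrite /= IHn; last lia.
rewrite /step_weight size_encode; case: ltnP => na.
  rewrite !big_geq; try lia.
  by rewrite Pa ?na // mul1r -exprD; congr (_ ^+ _); lia.
rewrite -exprD; congr (_ ^+ _); rewrite [in RHS]big_nat_recr //=.
suff -> : pair_cost (nth (true, false) (encode P k n) a.-1) (P n.+1, P (k - n.+1)%N) =
  ((P (n.+1 - a) && ~~ P n.+1) + (P (k - n.+1) && ~~ P (k - n.+1 + a)))%N by lia.
have [an|an] := ltnP a.-1 n.
  rewrite nth_encode // /pair_cost /=.
  have -> : (n - a.-1 = n.+1 - a)%N by lia.
  by have -> : (k - (n.+1 - a) = k - n.+1 + a)%N by lia.
(* Here x = a and the predecessor is 0, whose state (P 0, P k) equals the default value. *)
rewrite nth_default ?size_encode // /pair_cost /=.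
have -> : a = n.+1 by lia.
by rewrite subnn P0 subnK // (negbTE Pk).
Qed.

Lemma encode_state_words P k n : (forall x, (0 < x <= n)%N -> ~~ (P x && P (k - x)%N)) ->
  encode P k n \in state_words n.
Proof.
elim: n => // n IHn H; apply/allpairsP; exists (encode P k n, (P n.+1, P (k - n.+1)%N)).
split=> //=.
  by apply: IHn => x Hx; apply: H; lia.
by have := H n.+1; rewrite ltnSn ltn0Sn => /(_ isT); case: (P _); case: (P _).
Qed.

Lemma uniq_state_words n : uniq (state_words n).
Proof.
elim: n => // n IHn; apply: allpairs_uniq => //.
by move=> [l1 s1] [l2 s2] _ _ /= [-> ->].
Qed.

(** Each unit of cost marks a j in C but not in P: j = x or j = k - x + a. As 2n < k, the former lie
    in [a, n] and the latter in [a + k - n, k], so no j is counted twice. *)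
Lemma pair_cost_sum_le (P C : pred nat) (k a n : nat) :
  (2 * n < k)%N -> (forall j, (j < k.+1)%N -> P j -> C j) ->
  (forall j, (a <= j < k.+1)%N -> P (j - a)%N -> (a <= n)%N -> C j) ->
  (\sum_(0 <= j < k.+1) P j + \sum_(a <= x < n.+1)
        ((P (x - a) && ~~ P x) + (P (k - x) && ~~ P (k - x + a)))
   <= \sum_(0 <= j < k.+1) C j)%N.
Proof.
move=> nk PC PaC; have [an|an] := leqP a n; last first.
  rewrite [X in (_ + X)%N]big_geq // addn0 !big_nat.
  by apply: leq_sum => j /andP[_ /PC]; case: (P j) => // ->.
pose G j := (P (j - a)%N && ~~ P j).
have -> : (\sum_(a <= x < n.+1) ((P (x - a) && ~~ P x) + (P (k - x) && ~~ P (k - x + a))) =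
  \sum_(a <= x < n.+1) G x + \sum_(a + (k - n) <= y < k.+1) G y)%N.
  rewrite big_split /=; congr addn.
  rewrite big_nat_rev big_addn; have -> : (k.+1 - (k - n) = n.+1)%N by lia.
  apply: eq_big_nat => x Hx; rewrite /G.
  have -> : (k - (a + n.+1 - x.+1) = x + (k - n) - a)%N by lia.
  by rewrite subnK //; lia.
apply: (@leq_trans (\sum_(0 <= j < k.+1) P j +
   \sum_(0 <= j < k.+1 | (a <= j)%N) G j)%N); last first.
  rewrite [X in (_ + X)%N]big_mkcond -big_split /= !big_nat; apply: leq_sum => j /andP[_ jk].
  rewrite /G; have := PC j jk; case: (P j) => [->//|_]; first by rewrite andbF if_same.
  by case: (leqP a j) => // aj; rewrite /= andbT; case E: (P _) => //; rewrite PaC // aj.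
rewrite leq_add2l [leqRHS](big_cat_nat _ (n := n.+1)) //=; last lia.
rewrite leq_add //.
  rewrite [leqRHS](big_cat_nat _ (n := a)) //=; last lia.
  rewrite -[leqLHS]add0n leq_add // [leqLHS]big_nat_cond [leqRHS]big_nat_cond.
  by rewrite (eq_bigl (fun i => (a <= i < n.+1) && (a <= i))%N) // => i; lia.
rewrite [leqRHS](big_cat_nat _ (n := (a + (k - n))%N)) //=; try lia.
rewrite -[leqLHS]add0n leq_add // [leqLHS]big_nat_cond [leqRHS]big_nat_cond.
by rewrite (eq_bigl (fun i => (a + (k - n) <= i < k.+1) && (a <= i))%N) // => i; lia.
Qed.

(** * The golden ratio and the bound on [inner_sum] *)

Lemma phi_inv_sqr (R : realType) : (phi R)^-1 ^+ 2 = 1 - (phi R)^-1.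
Proof.
have p0 : 0 < phi R by rewrite /phi divr_gt0 // ltr_wpDr ?sqrtr_ge0.
have p2 : phi R ^+ 2 = phi R + 1.
  have s5 : Num.sqrt 5 ^+ 2 = 5 :> R by rewrite sqr_sqrtr.
  rewrite /phi; set s := Num.sqrt 5 in s5 *.
  have -> : ((1 + s) / 2) ^+ 2 = (1 + 2 * s + s ^+ 2) / 4 by field.
  by rewrite s5; lra.
have pn : phi R != 0 by rewrite gt_eqF.
rewrite (_ : 1 - (phi R)^-1 = (phi R ^+ 2 - phi R) / phi R ^+ 2); last by field.
by rewrite {1}p2 addrAC subrr add0r mul1r exprVn.
Qed.

Lemma phi_inv_bounds (R : realType) : 618 / 1000 < (phi R)^-1 < 6181 / 10000.
Proof.
have s5 : Num.sqrt 5 ^+ 2 = 5 :> R by rewrite sqr_sqrtr.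
have s0 : 0 <= Num.sqrt 5 :> R by apply: sqrtr_ge0.
have s1 : Num.sqrt 5 < 22361 / 10000 :> R by nra.
have s2 : 2236 / 1000 < Num.sqrt 5 :> R by nra.
have p0 : 0 < phi R by rewrite /phi divr_gt0 // ltr_wpDr ?sqrtr_ge0.
by rewrite -[(phi R)^-1]mul1r ltr_pdivlMr // ltr_pdivrMr // /phi; apply/andP; split; lra.
Qed.

Definition mem_below (k : nat) (A : {set 'I_k}) : pred nat := fun j => ~~ elem A j.

(* [a = k] is allowed when A has no positive element. *)
Definition least_pos (k : nat) (A : {set 'I_k}) (a : nat) : bool :=
  [&& [forall x : 'I_k, (0 < x < a)%N ==> (x \notin A)] & (a == k) || mem_below A a].

Lemma least_pos_exists (k : nat) (A : {set 'I_k}) : (0 < k)%N ->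
  exists2 a, (1 <= a < k.+1)%N & least_pos A a.
Proof.
move=> k0.
have ex : exists a, (0 < a)%N && ((a == k) || mem_below A a) by exists k; rewrite k0 eqxx.
case: (ex_minnP ex) => a /andP[a0 Ha] amin; exists a.
  rewrite a0 ltnS; by apply: amin; rewrite k0 eqxx.
rewrite /least_pos Ha andbT; apply/forallP => x; apply/implyP => /andP[x0 xa].
apply/negP => xA; have := amin x; rewrite x0 /mem_below elem_ord xA orbT => /(_ isT).
by rewrite leqNgt xa.
Qed.

Lemma in_Ak_pair (k : nat) (A : {set 'I_k}) (x : nat) : in_Ak A -> (x <= k)%N ->
  ~~ (mem_below A x && mem_below A (k - x)%N).
Proof.
case/in_AkP => _ Ak xk; apply: contra Ak => /andP[Hx Hkx].
by apply/in_sumsetP; exists x, (k - x)%N; rewrite subnKC.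
Qed.

(** The word misses only 0, which is always in A, and k / 2 for even k, which never is because k / 2
    + k / 2 = k. *)
Lemma encode_inj_Ak (k : nat) (A B : {set 'I_k}) : (0 < k)%N -> in_Ak A -> in_Ak B ->
  encode (mem_below A) k k.-1./2 = encode (mem_below B) k k.-1./2 -> A = B.
Proof.
move=> k0 AA AB E.
have EE x : (0 < x <= k.-1./2)%N ->
    mem_below A x = mem_below B x /\ mem_below A (k - x)%N = mem_below B (k - x)%N.
  move=> Hx; have lt : (k.-1./2 - x < k.-1./2)%N by lia.
  have := congr1 (fun s => nth (false, false) s (k.-1./2 - x)) E.
  by rewrite /= !nth_encode // (_ : k.-1./2 - _ = x)%N; [case | lia].
apply/setP => i; apply/negb_inj; rewrite -!elem_ord; apply/negb_inj.
rewrite -[~~ elem A i]/(mem_below A i) -[~~ elem B i]/(mem_below B i).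
have [i0|i0] := posnP i.
  have /in_AkP [A0 _] := AA; have /in_AkP [B0 _] := AB.
  by rewrite i0 /mem_below A0 B0.
have ik := ltn_ord i.
have [ih|ih] := leqP i k.-1./2; first by case: (EE i); rewrite ?i0.
have [mid|nmid] := eqVneq (i + i)%N k.
  have kii : (k - i = i)%N by lia.
  have := in_Ak_pair AA (ltnW ik); have := in_Ak_pair AB (ltnW ik).
  by rewrite kii !andbb => /negbTE -> /negbTE ->.
have odk := odd_double_half k.-1.
have [] := EE (k - i)%N; first by rewrite -muln2 in odk; lia.
by rewrite subKn ?(ltnW ik).
Qed.

(** A + A contains A because 0 is in A, and a + A if a is in A. *)
Lemma card_le_sumset_card (k n a : nat) (A : {set 'I_k}) : in_Ak A -> (0 < a)%N ->
  (2 * n < k)%N -> (a == k) || mem_below A a ->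
  (#|A| + \sum_(a <= x < n.+1)
        ((mem_below A (x - a) && ~~ mem_below A x) +
         (mem_below A (k - x) && ~~ mem_below A (k - x + a)))
   <= sumset_card A)%N.
Proof.
move=> AA a0 nk Ha; have [A0 _] := in_AkP _ AA.
rewrite /sumset_card (card_nat_pred k.+1 (in_sumset A)).
have -> : #|A| = (\sum_(0 <= j < k.+1) mem_below A j)%N.
  by rewrite card_gaps big_nat_recr //= /mem_below elem_ge // addn0.
apply: pair_cost_sum_le => // [j jk jA|j Hj jA an].
  by apply/in_sumsetP; exists 0%N, j.
(* The case a = k contradicts a <= n and 2n < k. *)
case/orP: Ha => [/eqP ak|aA]; first by lia.
by apply/in_sumsetP; exists a, (j - a)%N; split=> //; lia.
Qed.

(** Both sides are powers of y = 1 / phi < 1; the exponents compare by 2n <= k - 1 and the bound on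
    the cost by |C| - |A|. *)
Lemma phi_exp_le_path_weight (R : realType) (k a : nat) (A : {set 'I_k}) :
  (0 < k)%N -> (0 < a)%N -> in_Ak A -> least_pos A a ->
  phi R ^ (- (sumset_card A)%:Z + (#|A|)%:Z - k%:Z - 1) <=
  path_weight (phi R)^-1 a (encode (mem_below A) k k.-1./2).
Proof.
move=> k0 a0 AA /andP[/forallP Hlt Ha]; set n := k.-1./2.
have odk := odd_double_half k.-1; rewrite -muln2 -/n in odk.
have nk : (2 * n < k)%N by lia.
have H := card_le_sumset_card AA a0 nk Ha.
rewrite path_weight_encode //; last first.
- lia.
- by rewrite /mem_below elem_ge.
- by case/in_AkP: AA.
- move=> x /andP[x0 xa]; rewrite /mem_below negbK.
  have [xk|kx] := ltnP x k; last exact: elem_ge.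
  by have := implyP (Hlt (Ordinal xk)); rewrite -elem_ord /= x0 xa; apply.
move: H; set S := (\sum_(a <= x < n.+1) _)%N => H.
have -> : - (sumset_card A)%:Z + (#|A|)%:Z - k%:Z - 1 =
    - ((sumset_card A - #|A| + k + 1)%N%:Z).
  have cA : (#|A| <= sumset_card A)%N by apply: leq_trans H; rewrite leq_addr.
  by rewrite !PoszD -subzn //; ring.
rewrite -exprz_inv -exprnP; apply: ler_wiXn2l; last lia.
  by have /andP[] := phi_inv_bounds R; lra.
by have /andP[] := phi_inv_bounds R; lra.
Qed.

Lemma inner_sum_ge0 (R : realType) (k : nat) : 0 <= inner_sum R k.
Proof.
rewrite /inner_sum sumr_ge0 // => A _; apply: exprz_ge0.
by rewrite /phi divr_ge0 // addr_ge0 ?sqrtr_ge0.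
Qed.

Lemma sum_encoded_le (R : realType) (y : R) (k a n : nat) (Q : pred {set 'I_k}) :
  0 <= y -> {in Q &, injective (fun A => encode (mem_below A) k n)} ->
  (forall A, Q A -> encode (mem_below A) k n \in state_words n) ->
  \sum_(A | Q A) path_weight y a (encode (mem_below A) k n) <=
  \sum_(l <- state_words n) path_weight y a l.
Proof.
move=> y0 inj sub; set s := [seq encode (mem_below A) k n | A <- enum Q].
have us : uniq s by rewrite map_inj_in_uniq ?enum_uniq // => A B; rewrite !mem_enum; apply: inj.
have -> : \sum_(A | Q A) path_weight y a (encode (mem_below A) k n) = \sum_(l <- s) path_weight y a l.
  by rewrite big_map big_enum.
rewrite (perm_big [seq l <- state_words n | l \in s]) /=; last first.
  apply: uniq_perm => //; first by rewrite filter_uniq ?uniq_state_words.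
  move=> l; rewrite mem_filter; case: (boolP (l \in s)) => //= /mapP[A].
  by rewrite mem_enum => QA ->; rewrite sub.
rewrite big_filter big_mkcond; apply: ler_sum => l _.
by case: ifP => // _; apply: path_weight_ge0.
Qed.

(** The factor k counts the possible values of a; for each of them the sets inject into the words of
    length n. *)
Lemma inner_sum_le (R : realType) (k : nat) : (0 < k)%N ->
  inner_sum R k <= k%:R * (99 / 100) ^+ k.-1./2.
Proof.
move=> k0; set n := k.-1./2.
have nk : (n <= k)%N by have := odd_double_half k.-1; rewrite -muln2 -/n; lia.
set w := fun A : {set 'I_k} => phi R ^ (- (sumset_card A)%:Z + (#|A|)%:Z - k%:Z - 1).
have w0 A : 0 <= w A.
  by apply: exprz_ge0; rewrite /phi divr_ge0 // addr_ge0 ?sqrtr_ge0.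
have /andP[y_gt y_lt] := phi_inv_bounds R.
apply: (@le_trans _ _ (\sum_(1 <= a < k.+1) \sum_(A : {set 'I_k} | in_Ak A)
    (if least_pos A a then w A else 0))).
  rewrite /inner_sum exchange_big /=; apply: ler_sum => A AA.
  have [a Ha la] := least_pos_exists A k0.
  rewrite (bigD1_seq a) ?iota_uniq ?mem_index_iota //= la lerDl.
  by apply: sumr_ge0 => b _; case: ifP.
have -> : k%:R * (99 / 100) ^+ n = \sum_(1 <= a < k.+1) (99 / 100) ^+ n :> R.
  by rewrite sumr_const_nat subn1 mulr_natl.
apply: ler_sum_nat => a /andP[a0 _]; rewrite -big_mkcondr /=.
apply: le_trans (sum_path_weight n (phi_inv_sqr R) (phi_inv_bounds R) a0).
apply: (@le_trans _ _ (\sum_(A : {set 'I_k} | in_Ak A && least_pos A a)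
    path_weight (phi R)^-1 a (encode (mem_below A) k n))).
  by apply: ler_sum => A /andP[AA la]; apply: phi_exp_le_path_weight.
apply: sum_encoded_le; first lra.
  by move=> A B /andP[AA _] /andP[AB _]; apply: encode_inj_Ak.
move=> A /andP[AA _]; apply: encode_state_words => x /andP[_ xn].
by apply: in_Ak_pair => //; apply: leq_trans nk.
Qed.

Local Open Scope classical_set_scope.
Local Open Scope ring_scope.

(** * The limit *)

(** Cut at K: the head is a finite sum of convergent sequences, and the tails of both sides lie
    between 0 and S - P (K + 1), because c <= 1. *)
Lemma cvg_dominated_sum (R : realType) (a : nat -> R) (b : nat -> nat -> R) (c S : R) :
  0 <= c <= 1 ->
  (forall k, (0 < k)%N -> 0 <= a k) ->
  (forall g k, (0 < g)%N -> (0 < k)%N -> 0 <= b g k <= a k) ->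
  (forall k, (0 < k)%N -> (fun g => b g k) @ \oo --> c * a k) ->
  (fun n : nat => \sum_(1 <= k < n) a k) @ \oo --> S ->
  (fun g : nat => \sum_(1 <= k < g.+1) b g k) @ \oo --> c * S.
Proof.
move=> /andP[c0 c1] a0 b_bd b_cvg a_cvg.
pose P n := \sum_(1 <= k < n) a k.
have P_nd : nondecreasing_seq P.
  apply/nondecreasing_seqP => n; rewrite /P; case: n => [|n]; first by rewrite !big_geq.
  by rewrite [leRHS]big_nat_recr //= lerDl a0.
have P_le n : P n <= S.
  have <- : limn P = S by apply/cvg_lim.
  by apply: nondecreasing_cvgn_le => //; apply/cvg_ex; exists S.
apply/cvgrPdist_le => e e0.
have e4 : 0 < e / 4 by lra.
have [K _ HK] : \forall n \near \oo, `|S - P n| <= e / 4 by move/cvgrPdist_le: a_cvg; apply.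
have := HK K.+1; rewrite /= leqnSn => /(_ isT) {}HK.
have fin_cvg n : (fun g => \sum_(1 <= k < n.+1) b g k) @ \oo --> c * \sum_(1 <= k < n.+1) a k.
  rewrite mulr_sumr big_nat; under eq_cvg do rewrite big_nat.
  apply: cvg_big => [|k /andP[k1 _]]; first exact: add_continuous.
  exact: b_cvg.
move/cvgrPdist_le: (fin_cvg K) => /(_ _ e4) H.
near=> g.
have Hg : `|c * P K.+1 - \sum_(1 <= k < K.+1) b g k| <= e / 4 by near: g.
have gK : (K <= g)%N by near: g; apply: nbhs_infty_ge.
have g0 : (0 < g)%N by near: g; apply: nbhs_infty_gt.
rewrite (big_cat_nat _ (n := K.+1)) //=.
set B := \sum_(1 <= k < K.+1) _ in Hg *; set T := \sum_(K.+1 <= k < _) _.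
have T0 : 0 <= T.
  rewrite /T big_nat sumr_ge0 // => k /andP[Kk _].
  by have /andP[] := b_bd g k g0 (leq_ltn_trans (leq0n K) Kk).
have TP : T <= P g.+1 - P K.+1.
  rewrite /P [X in X - _](big_cat_nat _ (n := K.+1)) //= addrAC subrr add0r.
  apply: ler_sum_nat => k /andP[Kk _].
  by have /andP[] := b_bd g k g0 (leq_ltn_trans (leq0n K) Kk).
have := P_le g.+1; have := P_le K.+1.
move: HK Hg; rewrite !ler_norml => /andP[_ HK] /andP[Hg1 Hg2] Pg PK.
have cS : c * S = c * P K.+1 + c * (S - P K.+1) by ring.
have D0 : 0 <= S - P K.+1 by lra.
have cD : c * (S - P K.+1) <= S - P K.+1 by rewrite ler_piMl.
have cD0 : 0 <= c * (S - P K.+1) by rewrite mulr_ge0.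
rewrite cS; move: cD cD0; set x := c * (S - _); set z := c * P _ in Hg1 Hg2 *.
by move=> cD cD0; apply/andP; split; lra.
Unshelve. all: by end_near.
Qed.

(** * Asymptotics of the diagonal sums *)

Lemma phi_gt1 (R : realType) : 1 < phi R.
Proof.
have /andP[_ h] := phi_inv_bounds R; have p0 : 0 < phi R by rewrite /phi divr_gt0 // ltr_wpDr ?sqrtr_ge0.
by rewrite -[phi R]invrK invf_gt1 ?invr_gt0 //; lra.
Qed.

Lemma phi_sqr (R : realType) : phi R ^+ 2 = phi R + 1.
Proof.
have p1 := phi_gt1 R; have pn : phi R != 0 by rewrite gt_eqF //; lra.
have := phi_inv_sqr R; move/(congr1 (fun z => phi R ^+ 2 * z)).
rewrite /= exprVn divff ?expf_neq0 // mulrBr mulr1 expr2 mulfK //; lra.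
Qed.

Lemma diagonal_sum01 : (diagonal_sum 0 = 1)%N * (diagonal_sum 1 = 1)%N.
Proof. by rewrite /diagonal_sum !big_nat_recr //= !big_geq. Qed.

Lemma diagonal_sum_ind (Q : nat -> Prop) : Q 0%N -> Q 1%N ->
  (forall h, Q h -> Q h.+1 -> Q h.+2) -> forall h, Q h.
Proof.
move=> Q0 Q1 QS h; suff : Q h /\ Q h.+1 by case.
by elim: h => // h [H1 H2]; split=> //; apply: QS.
Qed.

Lemma diagonal_sum_le (R : realType) (h : nat) : (diagonal_sum h)%:R <= phi R ^+ h.
Proof.
have p1 := phi_gt1 R.
elim/diagonal_sum_ind: h => [||h H1 H2]; rewrite ?diagonal_sum01 ?expr0 ?expr1 //; first exact: ltW.
rewrite diagonal_sumSS natrD -addn2 exprD phi_sqr mulrDr mulr1 -exprSr.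
exact: lerD.
Qed.

(** Binet's formula: [1 - phi R] is the other root of x^2 = x + 1, and sqrt 5 is the difference of
    the roots. *)
Lemma diagonal_sum_binet (R : realType) (h : nat) :
  Num.sqrt 5 * (diagonal_sum h)%:R = phi R ^+ h.+1 - (1 - phi R) ^+ h.+1.
Proof.
have E : Num.sqrt 5 = 2 * phi R - 1 by rewrite /phi mulrC divfK ?pnatr_eq0 // addrAC subrr add0r.
have p2 := phi_sqr R.
have q2 : (1 - phi R) ^+ 2 = (1 - phi R) + 1 by rewrite sqrrB p2; ring.
elim/diagonal_sum_ind: h => [||h H1 H2].
- by rewrite diagonal_sum01 E !expr1; ring.
- by rewrite diagonal_sum01 E p2 q2; ring.
rewrite diagonal_sumSS natrD mulrDr H1 H2.
by rewrite -[h.+3]addn2 -[h.+2]addn1 !exprD p2 q2; ring.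
Qed.

Lemma cvg_diagonal_sum (R : realType) :
  (fun h : nat => (diagonal_sum h)%:R * phi R ^- h) @ \oo --> phi R / Num.sqrt 5.
Proof.
have p1 := phi_gt1 R; have pn : phi R != 0 by rewrite gt_eqF //; lra.
have s0 : Num.sqrt 5 != 0 :> R by rewrite sqrtr_eq0 -ltNge.
pose q := (1 - phi R) / phi R.
have qE h : (diagonal_sum h)%:R * phi R ^- h =
    phi R / Num.sqrt 5 - (1 - phi R) / Num.sqrt 5 * q ^+ h.
  have -> : (diagonal_sum h)%:R = (phi R ^+ h.+1 - (1 - phi R) ^+ h.+1) / Num.sqrt 5 :> R.
    by rewrite -diagonal_sum_binet mulrC mulKf.
  rewrite /q [(_ / phi R) ^+ h]expr_div_n !exprS.
  have: phi R ^+ h != 0 by rewrite expf_neq0.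
  move: (phi R ^+ h) ((1 - phi R) ^+ h) => X Y X0; field.
  by rewrite s0 X0.
have q1 : `|q| < 1.
  rewrite /q normf_div (gtr0_norm (lt_trans ltr01 p1)) ltr_pdivrMr ?(lt_trans ltr01 p1) // mul1r.
  by rewrite ltr_norml; lra.
rewrite (_ : (fun h => _) = (fun h => phi R / Num.sqrt 5 - (1 - phi R) / Num.sqrt 5 * q ^+ h)); last first.
  by apply/funext.
rewrite -[X in _ --> X]subr0; apply: cvgB; first exact: cvg_cst.
rewrite -[X in _ --> X](mulr0 ((1 - phi R) / Num.sqrt 5)).
by apply: cvgMl_tmp; apply: cvg_expr.
Qed.

(* The right-hand side is the closed form of the sum of 4 (m + 1) (99/100)^m over
   m < M; the terms k = 2m + 1 and k = 2m + 2 contribute less than its m-th term. *)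
Lemma sum_linear_geometric_le (R : realType) (M : nat) :
  \sum_(1 <= k < (2 * M).+1) k%:R * (99 / 100) ^+ k.-1./2 <=
  4 * 100 ^+ 2 * (1 - (99 / 100) ^+ M * (1 + M%:R / 100)) :> R.
Proof.
elim: M => [|M IHM]; first by rewrite big_geq // expr0 mul1r mul0r addr0 subrr mulr0.
have -> : (2 * M.+1).+1 = (2 * M).+3 by lia.
rewrite big_nat_recr //= big_nat_recr //=.
have -> : (2 * M)./2 = M by rewrite mul2n doubleK.
have -> : uphalf (2 * M) = M by rewrite mul2n uphalf_double.
apply: (le_trans (lerD (lerD IHM (lexx _)) (lexx _))).
have -> : (2 * M).+1%:R = 2 * M%:R + 1 :> R by rewrite -addn1 natrD natrM.
have -> : (2 * M).+2%:R = 2 * M%:R + 2 :> R by rewrite -addn2 natrD natrM.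
have -> : M.+1%:R = M%:R + 1 :> R by rewrite -addn1 natrD.
rewrite [_ ^+ M.+1]exprS.
have : 0 <= (99 / 100) ^+ M :> R by apply: exprn_ge0; lra.
have : 0 <= M%:R :> R by apply: ler0n.
move: ((99 / 100) ^+ M) M%:R => X m m0 X0.
by rewrite -subr_ge0; rewrite (_ : _ - _ = X) //; field.
Qed.

Lemma cvgn_inner_sum (R : realType) :
  cvgn (fun n : nat => \sum_(1 <= k < n) inner_sum R k).
Proof.
apply: nondecreasing_is_cvgn.
  apply/nondecreasing_seqP => n; case: n => [|n]; first by rewrite !big_geq.
  by rewrite [leRHS]big_nat_recr //= lerDl inner_sum_ge0.
(* The limit of the closed form in [sum_linear_geometric_le]. *)
exists (4 * 100 ^+ 2) => _ [n _ <-].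
apply: (@le_trans _ _ (\sum_(1 <= k < (2 * n).+1) inner_sum R k)).
  case: n => [|n]; first by rewrite !big_geq.
  rewrite [leRHS](big_cat_nat _ (n := n.+1)) //=; last lia.
  by rewrite lerDl sumr_ge0 // => k _; apply: inner_sum_ge0.
apply: (@le_trans _ _ (\sum_(1 <= k < (2 * n).+1) k%:R * (99 / 100) ^+ k.-1./2)).
  by apply: ler_sum_nat => k /andP[k0 _]; apply: inner_sum_le.
apply: le_trans (sum_linear_geometric_le R n) _.
have : 0 <= (99 / 100) ^+ n * (1 + n%:R / 100) :> R.
  by rewrite mulr_ge0 ?exprn_ge0 ?addr_ge0 ?divr_ge0 //; lra.
by move: (_ * _) => x x0; lra.
Qed.

(** * The contribution of a fixed k, and the conclusion *)

(** One factor phi is split off so that the remaining exponent is the index shift in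
    [long_count_eq]; the subtraction is exact since |A| <= k. *)
Lemma phi_exp_term (R : realType) (k : nat) (A : {set 'I_k}) :
  phi R ^ (- (sumset_card A)%:Z + (#|A|)%:Z - k%:Z - 1) =
  phi R * phi R ^- (k + 2 + sumset_card A - #|A|).
Proof.
have pn : phi R != 0 by rewrite gt_eqF // (lt_trans ltr01 (phi_gt1 R)).
have ak := card_ord_set_le A.
rewrite exprnN -[X in _ = X * _]expr1z -expfzDr //.
congr (_ ^ _); rewrite -subzn; last by apply: leq_trans ak _; rewrite -addnA leq_addr.
by rewrite !PoszD; ring.
Qed.

Definition long_term (R : realType) (g k : nat) : R :=
  (\sum_(A : {set 'I_k} | in_Ak A) long_count g A)%:R * phi R ^- g.

(** Termwise, [long_count] is at most phi^(g - e) with e = k + 2 + |C| - |A|, and 1 <= phi absorbs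
    the extra factor. *)
Lemma long_term_bounds (R : realType) (g k : nat) : (0 < g)%N -> (0 < k)%N ->
  0 <= long_term R g k <= inner_sum R k.
Proof.
move=> g0 k0; have p1 := phi_gt1 R; have p0 := lt_trans ltr01 p1.
have y0 : 0 <= phi R ^- g by rewrite invr_ge0 exprn_ge0 // ltW.
rewrite /long_term mulr_ge0 ?ler0n //= natr_sum mulr_suml /inner_sum; apply: ler_sum => A AA.
rewrite phi_exp_term ler_pdivrMr ?exprn_gt0 //.
have ak := card_ord_set_le A.
have w0 : 0 <= phi R * phi R ^- (k + 2 + sumset_card A - #|A|) * phi R ^+ g.
  by rewrite !mulr_ge0 ?invr_ge0 ?exprn_ge0 // ltW.
have := long_count_le g0 k0 AA; case: ifP => H; last first.
  by rewrite leqn0 => /eqP ->.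
rewrite -(ler_nat R) => /le_trans; apply.
apply: le_trans (diagonal_sum_le R _) _.
set h := (g + _ - _)%N; set e := (k + 2 + _ - _)%N.
have -> : g = (h + e)%N.
  by rewrite /h /e; move: H ak; move: (sumset_card A) #|A| => c a; lia.
rewrite exprD -mulrA [_^-1 * _]mulrCA mulVf ?expf_neq0 ?gt_eqF // mulr1.
by rewrite ler_peMl ?exprn_ge0 // ltW.
Qed.

Lemma cvg_long_term (R : realType) (k : nat) : (0 < k)%N ->
  (fun g => long_term R g k) @ \oo --> (Num.sqrt 5)^-1 * inner_sum R k.
Proof.
move=> k0; have p1 := phi_gt1 R; have p0 := lt_trans ltr01 p1.
rewrite /long_term /inner_sum mulr_sumr.
under eq_cvg do rewrite natr_sum mulr_suml.
apply: cvg_big => [|A AA]; first exact: add_continuous.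
have ak := card_ord_set_le A.
rewrite phi_exp_term; set e := (k + 2 + _ - _)%N.
have -> : (Num.sqrt 5)^-1 * (phi R * phi R ^- e) = phi R / Num.sqrt 5 * phi R ^- e.
  by rewrite mulrA [_^-1 * _]mulrC.
(* Shift the index by e: for large g, [long_count g A] is the diagonal sum at g - e. *)
have := @cvg_diagonal_sum R; rewrite -(cvg_centern e) => H.
apply: cvg_trans (cvgM H (cvg_cst (phi R ^- e))); apply: near_eq_cvg; near=> g.
have gk : (4 * k + 2 <= g)%N by near: g; apply: nbhs_infty_ge.
have ge : (e <= g)%N by near: g; apply: nbhs_infty_ge.
rewrite /= long_count_eq // -mulrA -invfM -exprD subnK //.
by congr (_%:R / _); congr diagonal_sum; rewrite /e; move: (sumset_card A) #|A| ak => c a ak; lia.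
Unshelve. all: by end_near. Qed.

(** The infinite series enters as the limit S of its partial sums, so its convergence is part of the
    claim. *)
Theorem theorem3p11 (R : realType) :
  exists S : R,
    (fun n : nat => \sum_(1 <= k < n) inner_sum R k) @ \oo --> S /\
    (fun g : nat => (t g)%:R * phi R ^- g) @ \oo -->
      phi R / Num.sqrt 5 + S / Num.sqrt 5.
Proof.
have /cvg_ex [S S_cvg] := @cvgn_inner_sum R; exists S; split=> //.
have c01 : 0 <= (Num.sqrt 5 : R)^-1 <= 1.
  rewrite invr_ge0 sqrtr_ge0 invf_le1 ?sqrtr_gt0 // -[leLHS]sqrtr1.
  by rewrite ler_sqrt //; lra.
have H := cvg_dominated_sum c01 (fun k _ => inner_sum_ge0 R k)
  (@long_term_bounds R) (@cvg_long_term R) S_cvg.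
rewrite [S / _]mulrC; apply: cvg_trans (cvgD (@cvg_diagonal_sum R) H).
apply: near_eq_cvg; near=> g.
have g0 : (0 < g)%N by near: g; apply: nbhs_infty_gt.
by rewrite /= t_decomposition // natrD mulrDl natr_sum mulr_suml.
Unshelve. all: by end_near. Qed.
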